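(* Let $\gamma \geq 0$ be an integer. The vector space of $\gamma$-edge valued binary trees (with at least one internal node), endowed with the operations $\hookleftarrow_a, \hookrightarrow_a$, $a \in [\gamma]$, defined in the context, is the free $\gamma$-multiplicial algebra over one generator.
   Context: The ground field has characteristic zero; $[\gamma] = \{1, \dots, \gamma\}$; $a \downarrow a' := \min(a, a')$. A $\gamma$-multiplicial algebra is a vector space with binary linear operations $\hookleftarrow_a, \hookrightarrow_a$, $a \in [\gamma]$, satisfying for all elements $x, y, z$ and all $a, a' \in [\gamma]$: $(x \hookrightarrow_{a'} y) \hookleftarrow_a z = x \hookrightarrow_{a'} (y \hookleftarrow_a z)$; $(x \hookleftarrow_{a'} y) \hookleftarrow_a z = x \hookleftarrow_{a \downarrow a'} (y \hookleftarrow_a z)$; $(x \hookrightarrow_a y) \hookrightarrow_{a \downarrow a'} z = x \hookrightarrow_a (y \hookrightarrow_{a'} z)$. Free over one generator is meant in the category of such algebras (morphisms: linear maps commuting with all operations). A $\gamma$-edge valued binary tree is a planar binary tree (each internal node has exactly two children) with at least one internal node, in which every edge connecting two internal nodes is labeled by an element of $[\gamma]$. By convention, all edges connecting internal nodes with leaves are labeled by $\infty$, with $a \downarrow \infty = a = \infty \downarrow a$ for $a \in [\gamma]$. The operations are defined linearly as follows, for $\gamma$-edge valued binary trees $\mathfrak{s}$ and $\mathfrak{t}$ and $a \in [\gamma]$. The tree $\mathfrak{t} \hookleftarrow_a \mathfrak{s}$ is obtained by replacing the label $y$ of each edge of the rightmost path of $\mathfrak{t}$ (from the root to the rightmost leaf,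 including the last edge, labeled $\infty$) by $a \downarrow y$, and then grafting the root of $\mathfrak{s}$ on the rightmost leaf of the resulting tree (so the edge leading to the root of $\mathfrak{s}$ is labeled by $a$). Symmetrically, $\mathfrak{s} \hookrightarrow_a \mathfrak{t}$ is obtained by replacing the label $x$ of each edge of the leftmost path of $\mathfrak{t}$ (including the last edge, labeled $\infty$) by $a \downarrow x$, and then grafting the root of $\mathfrak{s}$ on the leftmost leaf of the resulting tree. *)

(* Defs.v *)
(* {malg K[T]} (multinomials) is the free K-module on the choiceType T. *)
From HB Require Import structures.
From mathcomp Require Import all_boot all_order all_algebra.
From mathcomp Require Import finmap.
From mathcomp.multinomials Require Export monalg.

Set Implicit Arguments.
Unset Strict Implicit.
Unset Printing Implicit Defensive.

Import Order.TTheory GRing.Theory.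
Local Open Scope ring_scope.

(* The label set {1, ..., gamma} is represented by 'I_gamma = {0, ..., gamma-1};
   only its order is used, through Order.min. *)

Record is_multiplicial (K : fieldType) (gamma : nat) (V : lmodType K)
    (lop rop : 'I_gamma -> V -> V -> V) : Prop := IsMultiplicial {
  lop_linearl : forall a y, linear (fun x => lop a x y);
  lop_linearr : forall a x, linear (fun y => lop a x y);
  rop_linearl : forall a y, linear (fun x => rop a x y);
  rop_linearr : forall a x, linear (fun y => rop a x y);
  rop_lop : forall a a' x y z,
    lop a (rop a' x y) z = rop a' x (lop a y z);
  lop_lop : forall a a' x y z,
    lop a (lop a' x y) z = lop (Order.min a a') x (lop a y z);
  rop_rop : forall (a a' : 'I_gamma) x y z,
    rop (Order.min a a') (rop a x y) z = rop a x (rop a' y z)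
}.

Definition is_multiplicial_morphism (K : fieldType) (gamma : nat)
    (V W : lmodType K) (lopV ropV : 'I_gamma -> V -> V -> V)
    (lopW ropW : 'I_gamma -> W -> W -> W) (f : {linear V -> W}) : Prop :=
  forall a x y,
    f (lopV a x y) = lopW a (f x) (f y) /\ f (ropV a x y) = ropW a (f x) (f y).

Definition is_free_multiplicial_over (K : fieldType) (gamma : nat)
    (V : lmodType K) (lop rop : 'I_gamma -> V -> V -> V) (g : V) : Prop :=
  is_multiplicial lop rop /\
  forall (W : lmodType K) (lopW ropW : 'I_gamma -> W -> W -> W) (w : W),
    is_multiplicial lopW ropW ->
    exists f : {linear V -> W},
      [/\ is_multiplicial_morphism lop rop lopW ropW f, f g = w
        & forall h : {linear V -> W},
            is_multiplicial_morphism lop rop lopW ropW h -> h g = w -> h =1 f].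

Definition is_free_multiplicial_over_one_generator (K : fieldType)
    (gamma : nat) (V : lmodType K) (lop rop : 'I_gamma -> V -> V -> V) : Prop :=
  exists g : V, is_free_multiplicial_over lop rop g.

(* A tree is its root, an internal node, with a left and a right child. The
   child [None] is a leaf, reached by an edge labeled by infinity; the child
   [Some (a, t)] is an internal node, the root of t, reached by an edge labeled
   by a. *)
Inductive evtree (gamma : nat) : Type :=
  Node of option ('I_gamma * evtree gamma) & option ('I_gamma * evtree gamma).

Section EvtreeChoice.
Variable gamma : nat.

Fixpoint evtree_encode (t : evtree gamma) : GenTree.tree 'I_gamma :=
  let child c := match c with
    | None => GenTree.Node 1 [::]
    | Some (a, u) => GenTree.Node 2 [:: GenTree.Leaf a; evtree_encode u]
    end in
  let: Node l r := t in GenTree.Node 0 [:: child l; child r].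

Fixpoint evtree_decode (c : GenTree.tree 'I_gamma) : option (evtree gamma) :=
  let child d := match d with
    | GenTree.Node 2 [:: GenTree.Leaf a; e] =>
        omap (fun u => (a, u)) (evtree_decode e)
    | _ => None
    end in
  if c is GenTree.Node 0 [:: l; r] then Some (Node (child l) (child r))
  else None.

Lemma evtree_encodeK : pcancel evtree_encode evtree_decode.
Proof.
rewrite /pcancel; fix IH 1; move=> [l r].
by case: l => [[a t]|]; case: r => [[b u]|] //=; rewrite ?IH.
Qed.

HB.instance Definition _ :=
  Countable.copy (evtree gamma) (pcan_type evtree_encodeK).
End EvtreeChoice.

(* The label of the edge leading to the grafted tree is min(a, infinity) = a. *)
Fixpoint graft_right (gamma : nat) (a : 'I_gamma) (t s : evtree gamma)
    : evtree gamma :=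
  match t with
  | Node l None => Node l (Some (a, s))
  | Node l (Some (y, t')) => Node l (Some (Order.min a y, graft_right a t' s))
  end.

(* The tree s is grafted on the leftmost leaf of t. *)
Fixpoint graft_left (gamma : nat) (a : 'I_gamma) (s t : evtree gamma)
    : evtree gamma :=
  match t with
  | Node None r => Node (Some (a, s)) r
  | Node (Some (x, t')) r => Node (Some (Order.min a x, graft_left a s t')) r
  end.

Definition bilinear_ext (K : fieldType) (T : choiceType) (op : T -> T -> T)
    (u v : {malg K[T]}) : {malg K[T]} :=
  \sum_(t <- msupp u) \sum_(s <- msupp v) << u@_t * v@_s *g op t s >>.

Definition tree_lop (K : fieldType) (gamma : nat) (a : 'I_gamma)
    : {malg K[evtree gamma]} -> {malg K[evtree gamma]} -> {malg K[evtree gamma]} :=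
  bilinear_ext (graft_right a).

Definition tree_rop (K : fieldType) (gamma : nat) (a : 'I_gamma)
    : {malg K[evtree gamma]} -> {malg K[evtree gamma]} -> {malg K[evtree gamma]} :=
  bilinear_ext (graft_left a).

(* Main.v *)
(* Every tree factors as Node l r = l ↪_a (• ↩_b r), with either factor absent
   when the corresponding child is a leaf. This forces the value of a morphism on
   each tree once its value w on • is known, and conversely defines an evaluation
   of trees in any multiplicial algebra; the three axioms are exactly what the
   recursions for grafting along the right and left paths need for the evaluation
   to be a morphism. *)
Require Import Defs.
From HB Require Import structures.
From mathcomp Require Import all_boot all_order all_algebra.
From mathcomp Require Import finmap.
Import Order.TTheory GRing.Theory.
Local Open Scope ring_scope.
Local Open Scope fset_scope.

Set Implicit Arguments.
Unset Strict Implicit.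
Unset Printing Implicit Defensive.

Section LinearMaps.
Variables (R : nzRingType) (U V W : lmodType R).

Lemma linear_comp (g : V -> W) (f : U -> V) :
  linear g -> linear f -> linear (fun x => g (f x)).
Proof. by move=> gL fL a x y; rewrite fL gL. Qed.

End LinearMaps.

Section MalgLift.
Variables (R : nzRingType) (T : choiceType) (W : lmodType R).
Implicit Types (u v : {malg R[T]}).

Definition malg_lift (f : T -> W) u : W := \sum_(t <- msupp u) u@_t *: f t.

(** Allows lifts of elements with different supports to be compared over one index set. *)
Lemma malg_liftEw (f : T -> W) u (D : {fset T}) :
  msupp u `<=` D -> malg_lift f u = \sum_(t <- D) u@_t *: f t.
Proof.
move=> le_uD; apply: big_fset_incl => // t _ t_u.
by rewrite (mcoeff_outdom t_u) scale0r.
Qed.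

Lemma malg_lift_is_linear (f : T -> W) : linear (malg_lift f).
Proof.
(* The support of [a *: u + v] is put into [D] outright, which avoids bounding it by the other
   two. *)
move=> a u v; pose D := msupp u `|` msupp v `|` msupp (a *: u + v).
rewrite !(@malg_liftEw _ _ D) ?fsubsetUr //; last first.
- by rewrite /D -fsetUA fsubsetUl.
- by rewrite /D (fsetUC (msupp u)) -fsetUA fsubsetUl.
rewrite scaler_sumr -big_split /=; apply: eq_bigr => t _.
by rewrite mcoeffD mcoeffZ scalerDl scalerA.
Qed.

HB.instance Definition _ (f : T -> W) :=
  GRing.isLinear.Build R {malg R[T]} W *:%R (malg_lift f)
    (malg_lift_is_linear f).

Lemma malg_liftU (f : T -> W) t : malg_lift f << t >> = f t.
Proof. by rewrite /malg_lift msuppU oner_eq0 big_seq_fset1 mcoeffUU scale1r. Qed.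

Lemma malg_scaleU c (t : T) : << c *g t >> = c *: << t >> :> {malg R[T]}.
Proof. by apply/malgP => k; rewrite mcoeffZ !mcoeffU mulrnAr mulr1. Qed.

Lemma malg_linear_ext (f g : {malg R[T]} -> W) :
  linear f -> linear g -> (forall t, f << t >> = g << t >>) -> f =1 g.
Proof.
move=> fL gL eq_fg u.
pose fl := HB.pack_for {linear {malg R[T]} -> W} f
  (GRing.isLinear.Build _ _ _ _ f fL).
pose gl := HB.pack_for {linear {malg R[T]} -> W} g
  (GRing.isLinear.Build _ _ _ _ g gL).
rewrite -[f u]/(fl u) -[g u]/(gl u) (monalgE u) !linear_sum.
by apply: eq_bigr => t _; rewrite malg_scaleU !linearZ /= eq_fg.
Qed.

Lemma malg_bilinear_ext (f g : {malg R[T]} -> {malg R[T]} -> W) :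
    (forall v, linear (f ^~ v)) -> (forall u, linear (f u)) ->
    (forall v, linear (g ^~ v)) -> (forall u, linear (g u)) ->
    (forall s t, f << s >> << t >> = g << s >> << t >>) ->
  forall u v, f u v = g u v.
Proof.
move=> fLl fLr gLl gLr eq_fg u v.
apply: (malg_linear_ext (fLl v) (gLl v)) => s.
exact: (malg_linear_ext (fLr _) (gLr _)).
Qed.

End MalgLift.

Section BilinearExt.
Variables (K : fieldType) (T : choiceType) (op : T -> T -> T).
Implicit Types (u v : {malg K[T]}).

(** With [u] as the outer argument of [malg_lift], linearity in [u] is immediate; [bilinear_extEr]
    swaps the two sums to do the same for [v]. *)
Lemma bilinear_extEl u v :
  bilinear_ext op u v
    = malg_lift (fun t => malg_lift (fun s => << op t s >>) v) u.
Proof.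
apply: eq_bigr => t _; rewrite scaler_sumr; apply: eq_bigr => s _.
by rewrite malg_scaleU scalerA.
Qed.

Lemma bilinear_extEr u v :
  bilinear_ext op u v
    = malg_lift (fun s => malg_lift (fun t => << op t s >>) u) v.
Proof.
rewrite /bilinear_ext exchange_big /=.
apply: eq_bigr => t _; rewrite scaler_sumr; apply: eq_bigr => s _.
by rewrite malg_scaleU scalerA mulrC.
Qed.

Lemma bilinear_ext_linearl v : linear (fun u => bilinear_ext op u v).
Proof. by move=> a x y; rewrite !bilinear_extEl linearP. Qed.

Lemma bilinear_ext_linearr u : linear (bilinear_ext op u).
Proof. by move=> a x y; rewrite !bilinear_extEr linearP. Qed.

Lemma bilinear_extU t s :
  bilinear_ext op << t >> << s >> = << op t s >> :> {malg K[T]}.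
Proof. by rewrite bilinear_extEl !malg_liftU. Qed.

End BilinearExt.

(** Both sides are trilinear, so basis elements suffice. The four operations are kept distinct so
    that all three axioms are instances. *)
Lemma bilinear_ext_assoc (K : fieldType) (T : choiceType)
    (op1 op2 op3 op4 : T -> T -> T) :
    (forall r s t, op1 (op2 r s) t = op3 r (op4 s t)) ->
  forall u v w : {malg K[T]},
    bilinear_ext op1 (bilinear_ext op2 u v) w
      = bilinear_ext op3 u (bilinear_ext op4 v w).
Proof.
move=> opA u v w; move: u.
have L := @bilinear_ext_linearl K T; have Rr := @bilinear_ext_linearr K T.
apply: malg_linear_ext (linear_comp (L op1 w) (L op2 v)) (L op3 _) _ => r.
move: v w; apply: malg_bilinear_ext => [w|v|w|v|s t].
- exact: linear_comp (L op1 w) (Rr op2 _).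
- exact: Rr.
- exact: linear_comp (Rr op3 _) (L op4 w).
- exact: linear_comp (Rr op3 _) (Rr op4 v).
- by rewrite !bilinear_extU opA.
Qed.

(** Subtrees sit inside options and pairs, where the automatically generated principle gives no
    induction hypothesis. *)
Lemma evtree_ind_children (gamma : nat) (P : evtree gamma -> Prop) :
    (forall l r, (forall a t, l = Some (a, t) -> P t) ->
                 (forall a t, r = Some (a, t) -> P t) -> P (Node l r)) ->
  forall t, P t.
Proof.
move=> PNode; fix IH 1; case=> l r; apply: PNode.
- by case: l => [[b u]|] a t; [case=> _ <-; exact: IH|discriminate].
- by case: r => [[b u]|] a t; [case=> _ <-; exact: IH|discriminate].
Qed.

Section Grafting.
Variable gamma : nat.
Implicit Types (a b : 'I_gamma) (r s t : evtree gamma).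

Lemma graft_right_left a b r s t :
  graft_right a (graft_left b r s) t = graft_left b r (graft_right a s t).
Proof. by case: s => [[[x s1]|] [[y s2]|]]. Qed.

(** The rightmost path of [graft_right b r s] runs through [r], then the new edge, then [s]. The
    outer grafting caps all of it by [a], so edges of [r] are capped by both [a] and [b]. *)
Lemma graft_right_right a b r s t :
  graft_right a (graft_right b r s) t
    = graft_right (Order.min a b) r (graft_right a s t).
Proof.
elim/evtree_ind_children: r => l [[y r]|] _ IH //=.
by rewrite (IH y) // minA.
Qed.

Lemma graft_left_left a b r s t :
  graft_left (Order.min a b) (graft_left a r s) t
    = graft_left a r (graft_left b s t).
Proof.
elim/evtree_ind_children: t => [[[x t]|] q] IH _ //=.
by rewrite (IH x) // minA.
Qed.

End Grafting.

Lemma tree_multiplicial (K : fieldType) (gamma : nat) :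
  is_multiplicial (@tree_lop K gamma) (@tree_rop K gamma).
Proof.
split=> [a y|a x|a y|a x|a b|a b|a b].
- exact: bilinear_ext_linearl.
- exact: bilinear_ext_linearr.
- exact: bilinear_ext_linearl.
- exact: bilinear_ext_linearr.
- exact: bilinear_ext_assoc (graft_right_left a b).
- exact: bilinear_ext_assoc (graft_right_right a b).
- exact: bilinear_ext_assoc (graft_left_left a b).
Qed.

Section Evaluation.
Variables (K : fieldType) (gamma : nat) (W : lmodType K).
Variables (lop rop : 'I_gamma -> W -> W -> W) (w : W).
Hypothesis multW : is_multiplicial lop rop.

Fixpoint eval_tree (t : evtree gamma) : W :=
  let: Node l r := t in
  let x := if r is Some (b, u) then lop b w (eval_tree u) else w in
  if l is Some (a, u) then rop a (eval_tree u) x else x.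

(** [rop_lop] moves the grafting past the left child, and [lop_lop] passes it down the right edge
    [y] with label [Order.min a y], as [graft_right] does. *)
Lemma eval_graft_right a t s :
  eval_tree (graft_right a t s) = lop a (eval_tree t) (eval_tree s).
Proof.
elim/evtree_ind_children: t => [[[x l]|] [[y r]|]] _ IH /=;
  by rewrite ?(IH y) // ?(rop_lop multW) ?(lop_lop multW).
Qed.

Lemma eval_graft_left a s t :
  eval_tree (graft_left a s t) = rop a (eval_tree s) (eval_tree t).
Proof.
elim/evtree_ind_children: t => [[[x l]|] r] IH _ //=.
by rewrite (IH x) // (rop_rop multW).
Qed.

Lemma eval_morphism :
  is_multiplicial_morphism (@tree_lop K gamma) (@tree_rop K gamma) lop rop
    (malg_lift eval_tree).
Proof.
have evL := @malg_lift_is_linear K (evtree gamma) W.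
move=> a u v; split; move: u v; apply: malg_bilinear_ext => *.
- exact: linear_comp (evL _) (bilinear_ext_linearl _ _).
- exact: linear_comp (evL _) (bilinear_ext_linearr _ _).
- exact: linear_comp (lop_linearl multW _ _) (evL _).
- exact: linear_comp (lop_linearr multW _ _) (evL _).
- by rewrite /tree_lop bilinear_extU /= !malg_liftU eval_graft_right.
- exact: linear_comp (evL _) (bilinear_ext_linearl _ _).
- exact: linear_comp (evL _) (bilinear_ext_linearr _ _).
- exact: linear_comp (rop_linearl multW _ _) (evL _).
- exact: linear_comp (rop_linearr multW _ _) (evL _).
- by rewrite /tree_rop bilinear_extU /= !malg_liftU eval_graft_left.
Qed.

Lemma morphism_eval_tree (h : {linear {malg K[evtree gamma]} -> W}) t :
    is_multiplicial_morphism (@tree_lop K gamma) (@tree_rop K gamma)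
      lop rop h ->
    h << Node None None >> = w ->
  h << t >> = eval_tree t.
Proof.
move=> hM hw; elim/evtree_ind_children: t => l r IHl IHr.
(* [Node None r] is a right grafting onto the one-node tree; the left child is then grafted onto
   [Node None r]. *)
have hNoder : h << Node None r >> = eval_tree (Node None r).
  case: r IHr => [[b u]|] //= /(_ b u erefl) <-.
  rewrite -hw -(hM b _ _).1; congr (h _).
  by rewrite /tree_lop bilinear_extU.
case: l IHl => [[a s]|] //= /(_ a s erefl) <-.
rewrite -[X in rop a _ X]/(eval_tree (Node None r)) -hNoder -(hM a _ _).2.
by rewrite /tree_rop bilinear_extU.
Qed.

End Evaluation.

Theorem theorem6p1p6 (K : fieldType) (charK : [pchar K] =i pred0) (gamma : nat) :
  is_free_multiplicial_over_one_generator
    (@tree_lop K gamma) (@tree_rop K gamma).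
Proof.
(* The generator is the tree with a single internal node. *)
exists << Node None None >>; split; first exact: tree_multiplicial.
move=> W lopW ropW w multW; exists (malg_lift (eval_tree lopW ropW w)); split.
- exact: eval_morphism.
- exact: malg_liftU.
- move=> h hM hw; apply: malg_linear_ext => [a x y||t].
  + by rewrite linearP.
  + exact: malg_lift_is_linear.
  + by rewrite /= malg_liftU (morphism_eval_tree _ hM hw).
Qed.
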